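(* Let $K$ be a field, let $x$, $y$, $z$ be pairwise disjoint finite lists of indeterminates, and let $f\in K[x]$, $g\in K[y]$, $h\in K[z]$. Let $X$, $X'$, $X''$ be $3$-matrix factorizations of $f$, $g$, $h$ respectively. Then there is an identity $$(X\,\overline{\otimes}_3\,X')\,\overline{\otimes}_3\,X''=X\,\overline{\otimes}_3\,(X'\,\overline{\otimes}_3\,X'')$$ in $MF(K[x,y,z],fgh)_3$.
   Context: For a list of indeterminates $x$, $K(x)$ denotes the field of fractions of $K[x]$. Matrices over $K(x)$, $K(y)$, etc. are regarded as matrices over the fraction field of the polynomial ring in all the indeterminates involved. A $3$-matrix factorization of size $n$ of a polynomial $f\in K[x]$ is a triplet $(\phi,\psi,\theta)$ of $n\times n$ matrices with entries in $K(x)$ such that $\phi\psi\theta=fI_n$. The category $MF(K[x],f)_3$ has as objects the $3$-matrix factorizations of $f$ (of all sizes). A morphism from $(\phi_1,\psi_1,\theta_1)$ of size $n_1$ to $(\phi_2,\psi_2,\theta_2)$ of size $n_2$ is a triplet $(\alpha,\beta,\delta)$ of $n_2\times n_1$ matrices over $K(x)$ such that $\alpha\phi_1=\phi_2\beta$, $\psi_2\delta=\beta\psi_1$ and $\delta\theta_1=\theta_2\alpha$; composition is componentwise matrix multiplication. The same definitions apply with any other list of indeterminates and any polynomial in them. The multiplicative tensor product of $3$-matrix factorizations of polynomials in disjoint lists of indeterminates is $(\phi,\psi,\theta)\,\overline{\otimes}_3\,(\phi',\psi',\theta')=(\phi\otimes\phi',\psi\otimes\psi',\theta\otimes\theta')$,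 where $\otimes$ is the standard tensor (Kronecker) product of matrices; it is a $3$-matrix factorization of the product of the two polynomials. *)

(* Defs.v *)
From mathcomp Require Import all_boot all_algebra.
From mathcomp.multinomials Require Export mpoly.
From mathcomp.real_closed Require Export mxtens.

Set Implicit Arguments.
Unset Strict Implicit.
Unset Printing Implicit Defensive.

Import GRing.Theory.
Local Open Scope ring_scope.

(** All the indeterminates at hand are named by the elements of 'I_N, for an
    arbitrary N.  A list x of indeterminates is a sequence over 'I_N; K[x] is a
    subring of {mpoly K[N]}, and K(x) is a subfield of the fraction field of
    {mpoly K[N]}.  In this way a matrix over K(x) is, with no conversion, also a
    matrix over K(x ++ y). *)

Definition inKpoly (K : fieldType) (N : nat) (x : seq 'I_N) (p : {mpoly K[N]}) : Prop :=
  forall (m : 'X_{1..N}) (i : 'I_N), m \in msupp p -> i \notin x -> m i = 0%N.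

Definition inKfrac (K : fieldType) (N : nat) (x : seq 'I_N)
    (r : {fraction {mpoly K[N]}}) : Prop :=
  exists p q : {mpoly K[N]},
    [/\ inKpoly x p, inKpoly x q, q != 0 & r = tofrac p / tofrac q].

Definition mx_inKfrac (K : fieldType) (N : nat) (x : seq 'I_N) (m n : nat)
    (A : 'M[{fraction {mpoly K[N]}}]_(m, n)) : Prop :=
  forall i j, inKfrac x (A i j).

(** The size is a field of the record, so that an equality between triples says
    that the sizes agree and that the matrices agree entry by entry. *)
Record mxtriple (R : Type) : Type := MxTriple {
  tsize : nat;
  tphi : 'M[R]_tsize;
  tpsi : 'M[R]_tsize;
  ttheta : 'M[R]_tsize
}.

(** The objects of MF(K[x], f)_3. *)
Record isMF3 (K : fieldType) (N : nat) (x : seq 'I_N) (f : {mpoly K[N]})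
    (X : mxtriple {fraction {mpoly K[N]}}) : Prop := IsMF3 {
  mf3_poly : inKpoly x f;
  mf3_phi : mx_inKfrac x (tphi X);
  mf3_psi : mx_inKfrac x (tpsi X);
  mf3_theta : mx_inKfrac x (ttheta X);
  mf3_eq : tphi X *m tpsi X *m ttheta X = (tofrac f)%:M
}.

(** [tensmx] is the Kronecker product: the entry of [A *t B] at row [i * p + k]
    and column [j * q + l] is [A i j * B k l], where B has p rows and q columns. *)
Definition mtens3 (R : pzRingType) (X Y : mxtriple R) : mxtriple R :=
  MxTriple (tensmx (tphi X) (tphi Y)) (tensmx (tpsi X) (tpsi Y))
           (tensmx (ttheta X) (ttheta Y)).

Notation "X '⊗₃' Y" := (mtens3 X Y) (at level 40, left associativity).

(* Main.v *)
Require Import Defs.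
From mathcomp Require Import all_boot all_algebra.

(** The Kronecker product is strictly associative, not merely up to a
    permutation of the basis: when the pairs of indices are ordered
    lexicographically, both bracketings of a triple product list the triples
    [(i, j, k)] in lexicographic order, and the entries agree because the
    product of scalars is associative ([tensmxA]).  Applied to the three
    components, this gives the equality of triples, the sizes being equal by
    associativity of the product of natural numbers.

    That both sides are objects of the category over all the indeterminates
    follows by using twice the fact that the multiplicative tensor product of
    factorizations of [f] and [g] is a factorization of [f * g] ([isMF3_tens]).
    This is the mixed product rule
    [(A *t B) *m (C *t D) = (A *m C) *t (B *m D)]
    together with the fact that the Kronecker product of two scalar matrices is
    the scalar matrix of the product; the entries stay in the right field since
    each K(x) is closed under products and grows with x. *)

Import GRing.Theory.
Local Open Scope ring_scope.

Section Indeterminates.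

Context {K : fieldType} {N : nat}.
Implicit Types (x y : seq 'I_N) (p q : {mpoly K[N]}).
Implicit Types (r s : {fraction {mpoly K[N]}}).

Lemma inKpoly_sub x y p : {subset x <= y} -> inKpoly x p -> inKpoly y p.
Proof.
by move=> sxy px m i mp iy; apply: px mp _; apply: contraNN iy => /sxy.
Qed.

(** Each monomial of a product is a product of monomials of the factors, so it
    involves no further indeterminate. *)
Lemma inKpolyM x p q : inKpoly x p -> inKpoly x q -> inKpoly x (p * q).
Proof.
move=> px qx m i /msuppM_le/allpairsP[[m1 m2] /= [m1p m2q ->]] ix.
by rewrite mnmDE (px _ _ m1p ix) (qx _ _ m2q ix).
Qed.

Lemma inKfrac_sub x y r : {subset x <= y} -> inKfrac x r -> inKfrac y r.
Proof.
move=> sxy [p [q [px qx q0 ->]]].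
by exists p, q; split=> //; apply: inKpoly_sub sxy _.
Qed.

Lemma inKfracM x r s : inKfrac x r -> inKfrac x s -> inKfrac x (r * s).
Proof.
move=> [p [q [px qx q0 ->]]] [p' [q' [p'x q'x q'0 ->]]].
exists (p * p'), (q * q'); split; [exact: inKpolyM | exact: inKpolyM | |].
  by rewrite mulf_neq0.
by rewrite !tofracM invfM mulrACA.
Qed.

Lemma mx_inKfrac_tens x y m n m' n' (A : 'M[{fraction {mpoly K[N]}}]_(m, n))
    (B : 'M[{fraction {mpoly K[N]}}]_(m', n')) :
  mx_inKfrac x A -> mx_inKfrac y B -> mx_inKfrac (x ++ y) (tensmx A B).
Proof.
move=> Ax By i j; rewrite mxE; apply: inKfracM.
- by apply: inKfrac_sub (Ax _ _) => k kx; rewrite mem_cat kx.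
- by apply: inKfrac_sub (By _ _) => k ky; rewrite mem_cat ky orbT.
Qed.

End Indeterminates.

Lemma tensmx_scalar (R : pzRingType) (m n : nat) (a b : R) :
  tensmx (a%:M : 'M_m) (b%:M : 'M_n) = (a * b)%:M.
Proof.
apply/matrixP=> i j.
case: (mxtens_indexP i) => i1 i2; case: (mxtens_indexP j) => j1 j2.
rewrite tensmxE !mxE (can_eq (@mxtens_indexK _ _)) xpair_eqE.
by case: (i1 == j1); case: (i2 == j2); rewrite /= ?mulr0n ?mul0r ?mulr0.
Qed.

(** Lexicographic ranks of triples do not depend on the bracketing:
    [i * (n * p) + (j * p + k) = (i * n + j) * p + k]. *)
Lemma mxtens_indexA (m n p : nat) (i : 'I_m) (j : 'I_n) (k : 'I_p) :
  cast_ord (mulnA m n p) (mxtens_index (i, mxtens_index (j, k)))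
  = mxtens_index (mxtens_index (i, j), k).
Proof. by apply: val_inj; rewrite /= mulnDl mulnA addnA. Qed.

Lemma tensmxA (R : pzRingType) (m n p m' n' p' : nat)
    (A : 'M[R]_(m, m')) (B : 'M[R]_(n, n')) (C : 'M[R]_(p, p')) :
  castmx (esym (mulnA m n p), esym (mulnA m' n' p')) (tensmx (tensmx A B) C)
  = tensmx A (tensmx B C).
Proof.
apply/matrixP=> i j; rewrite castmxE !esymK.
case: (mxtens_indexP i) => i1 i23; case: (mxtens_indexP i23) => i2 i3.
case: (mxtens_indexP j) => j1 j23; case: (mxtens_indexP j23) => j2 j3.
by rewrite !mxtens_indexA !tensmxE mulrA.
Qed.

(** The casts make it possible to compare components whose sizes are equal only
    propositionally. *)
Lemma mxtriple_eq (R : Type) (X Y : mxtriple R) (e : Defs.tsize X = Defs.tsize Y) :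
  castmx (e, e) (tphi X) = tphi Y -> castmx (e, e) (tpsi X) = tpsi Y ->
  castmx (e, e) (ttheta X) = ttheta Y -> X = Y.
Proof.
case: X Y e => [m a b c] [n a' b' c'] /= e; case: n / e a' b' c' => a' b' c'.
by rewrite !castmx_id => -> -> ->.
Qed.

Lemma mtens3A (R : pzRingType) (X Y Z : mxtriple R) :
  (X ⊗₃ Y) ⊗₃ Z = X ⊗₃ (Y ⊗₃ Z).
Proof.
have e := esym (mulnA (Defs.tsize X) (Defs.tsize Y) (Defs.tsize Z)).
apply: (@mxtriple_eq _ ((X ⊗₃ Y) ⊗₃ Z) (X ⊗₃ (Y ⊗₃ Z)) e);
  rewrite (eq_irrelevance e (esym (mulnA _ _ _))); exact: tensmxA.
Qed.

Lemma isMF3_tens (K : fieldType) (N : nat) (x y : seq 'I_N)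
    (f g : {mpoly K[N]}) (X Y : mxtriple {fraction {mpoly K[N]}}) :
  isMF3 x f X -> isMF3 y g Y -> isMF3 (x ++ y) (f * g) (X ⊗₃ Y).
Proof.
move=> [fx phix psix thetax eqX] [gy phiy psiy thetay eqY].
split; try exact: mx_inKfrac_tens.
- apply: inKpolyM.
  + by apply: inKpoly_sub fx => k kx; rewrite mem_cat kx.
  + by apply: inKpoly_sub gy => k ky; rewrite mem_cat ky orbT.
- by rewrite /= !tensmx_mul eqX eqY tensmx_scalar tofracM.
Qed.

Theorem proposition5p1 (K : fieldType) (N : nat) (x y z : seq 'I_N)
    (ux : uniq x) (uy : uniq y) (uz : uniq z)
    (dxy : [disjoint x & y]) (dxz : [disjoint x & z]) (dyz : [disjoint y & z])
    (f g h : {mpoly K[N]})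
    (fx : inKpoly x f) (gy : inKpoly y g) (hz : inKpoly z h)
    (X X' X'' : mxtriple {fraction {mpoly K[N]}})
    (hX : isMF3 x f X) (hX' : isMF3 y g X') (hX'' : isMF3 z h X'') :
  [/\ isMF3 (x ++ y ++ z) (f * g * h) ((X ⊗₃ X') ⊗₃ X''),
      isMF3 (x ++ y ++ z) (f * g * h) (X ⊗₃ (X' ⊗₃ X''))
    & (X ⊗₃ X') ⊗₃ X'' = X ⊗₃ (X' ⊗₃ X'')].
Proof.
have assoc := @mtens3A _ X X' X''.
have leftMF : isMF3 (x ++ y ++ z) (f * g * h) ((X ⊗₃ X') ⊗₃ X'').
  by rewrite catA; apply: isMF3_tens hX''; apply: isMF3_tens.
by split; rewrite -?assoc.
Qed.
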